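(* For each $n\in\mathbb{N}_0$ let $(T\psi_n)(z)=(\psi_0*\psi_n)(z)$, $z\in\mathbb{C}$, denote the holomorphic (entire) extension of the function $u\mapsto(\psi_0*\psi_n)(u)$, $u\in\mathbb{R}$. Then for all $z,w\in\mathbb{C}$, $$\sum_{n=0}^{\infty}(T\psi_n)(z)\,\overline{(T\psi_n)(w)}=\sum_{n=0}^{\infty}(\psi_0*\psi_n)(z)\,\overline{(\psi_0*\psi_n)(w)}=e^{-\frac{(z-\overline{w})^2}{4}}=K_{RBF}(z,w).$$
   Context: The Hermite polynomials $H_n$ are defined by $e^{2xz-z^2}=\sum_{n\ge 0}\frac{H_n(x)}{n!}z^n$, and the normalized Hermite functions are $\psi_n(x)=\frac{e^{-x^2/2}H_n(x)}{\sqrt{n!\,2^n\sqrt{\pi}}}$. The convolution is $(g*f)(u)=\int_{\mathbb{R}}g(u-x)f(x)\,dx$, $u\in\mathbb{R}$, and $Tf=\psi_0*f$. The (complex) Gaussian RBF kernel is $K_{RBF}(z,w)=\exp\left(-\frac{(z-\overline{w})^2}{4}\right)$. *)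

(* Defs.v *)
From HB Require Import structures.
From mathcomp Require Import all_boot all_order all_algebra.
From mathcomp Require Import all_classical all_reals all_analysis.
From mathcomp Require Import complex.

Set Implicit Arguments.
Unset Strict Implicit.
Unset Printing Implicit Defensive.

Import Order.TTheory GRing.Theory Num.Theory.
Import numFieldNormedType.Exports.

Local Open Scope classical_set_scope.
Local Open Scope ring_scope.
Local Open Scope complex_scope.

(* Since a real power series determines its coefficients, this property
   characterizes H uniquely. *)
Definition hermite_polynomials (R : realType) (H : nat -> {poly R}) : Prop :=
  forall x z : R,
    series (fun n => (H n).[x] / n`!%:R * z ^+ n) @ \oo
      --> expR (2 * x * z - z ^+ 2).

Definition hermite_function (R : realType) (H : nat -> {poly R}) (n : nat)
    (x : R) : R :=
  expR (- (x ^+ 2 / 2)) * (H n).[x]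
    / Num.sqrt (n`!%:R * 2 ^+ n * Num.sqrt (pi : R)).

Definition convolution (R : realType) (g f : R -> R) (u : R) : R :=
  \int[@lebesgue_measure R]_(x in [set: R]) (g (u - x) * f x).

Definition convolution_psi0 (R : realType) (H : nat -> {poly R})
    (f : R -> R) : R -> R :=
  convolution (hermite_function H 0) f.

(* R[i]^o is R[i] as a normed space over itself, so that derivability at z in
   the direction 1 is complex differentiability at z. *)
Definition entire (R : realType) (F : R[i] -> R[i]) : Prop :=
  forall z : R[i], derivable (F : R[i]^o -> R[i]^o) z 1.

Definition entire_extension (R : realType) (f : R -> R)
    (F : R[i] -> R[i]) : Prop :=
  entire F /\ (forall u : R, F u%:C = (f u)%:C).

Definition cexp (R : realType) (z : R[i]) : R[i] :=
  (expR (complex.Re z))%:C *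
    (cos (complex.Im z) +i* sin (complex.Im z)).

Definition K_RBF (R : realType) (z w : R[i]) : R[i] :=
  cexp (- ((z - w^*) ^+ 2 / 4)).

(* Main.v *)
Require Import Defs.
From HB Require Import structures.
From mathcomp Require Import all_boot all_order all_algebra.
From mathcomp Require Import all_classical all_reals all_analysis.
From mathcomp Require Import measurable_realfun complex ring lra.
Set Implicit Arguments.
Unset Strict Implicit.
Unset Printing Implicit Defensive.

Import Order.TTheory GRing.Theory Num.Theory.
Import numFieldNormedType.Exports.
Local Open Scope classical_set_scope.
Local Open Scope ring_scope.
Local Open Scope complex_scope.

(** The convolution can be computed in closed form.  Differentiating the
    generating function exp(2xz - z^2) in z gives the three-term recurrence of
    the Hermite polynomials, hence H_(n+1) = 2X H_n - H_n'.  The product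
    psi_0(u - x) psi_n(x) is H_n(x) exp(-(x - u/2)^2) up to a factor independent
    of x, and integrating by parts against this Gaussian turns the step
    p -> 2X p - p' into multiplication by u.  Therefore
      (psi_0 * psi_n)(u) = exp(-u^2/4) u^n / sqrt(n! 2^n)
    ([convolution_psi0_hermite]), which visibly has an entire extension.

    The extension is unique: an entire function that vanishes on the real line
    vanishes everywhere ([entire_eq0_real]).  Entire only means complex
    differentiable at every point, so this rests on Goursat's bisection argument
    ([loop_integral_eq0]).  If F is zero on the real axis and F(z0) <> 0 with
    Im z0 > 0, integrate F(z) exp(-N (z - z0)^2) around a rectangle whose bottom
    lies on the real axis and whose top side has z0 as its midpoint.  The bottom
    contributes 0; on the top the factor is a real Gaussian peaked at z0; on the
    vertical sides, which are far enough from z0, the factor is exponentially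
    smaller.  The total being 0, letting N tend to infinity yields a
    contradiction.

    With the extensions identified, the series is
      exp(-z^2/4) exp(-(w^* )^2/4) sum_n (z w^* / 2)^n / n!,
    and the exponential series sums to exp(z w^* / 2) ([cvg_cexp]); completing
    the square gives the kernel. *)

(** * Real power series and the Hermite recurrence *)
Section power_series.
Context {R : realType}.
Implicit Types (c : R ^nat) (x z : R).

(** The factor n + 1 is absorbed by evaluating the original series at the
    larger radius 2 (|x| + 1), since n + 1 <= 2 ^ (n + 1). *)
Lemma cvgn_pseries_diffs c : (forall x, cvgn (pseries c x)) ->
  forall x, cvgn (pseries (pseries_diffs c) x).
Proof.
move=> cc x; pose r := 2 * (`|x| + 1).
have r0 : 0 < r by rewrite mulr_gt0// ltr_wpDl.
have : cvgn (pseries (fun n => `|c n|) r).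
  apply: (@is_cvg_pseries_inside_norm _ _ (r + 1)) => //.
  by rewrite !gtr0_norm ?addr_gt0// ltrDl.
rewrite /pseries => /cvg_ex[l /=]; rewrite -cvg_shiftS => cl.
have {}cl : cvgn (series (fun n => `|c n.+1| * r ^+ n.+1)).
  apply/cvg_ex; exists (l - `|c 0%N|) => /=.
  rewrite [X in X @ _ --> _](_ : _ = fun n => [series `|c i| * r ^+ i]_i n.+1 - `|c 0%N|).
    by apply: cvgB => //; exact: cvg_cst.
  apply/funext => n; rewrite /series/= big_nat_recl//= expr0 mulr1.
  by rewrite addrC addKr.
apply: normed_cvg; apply: series_le_cvg cl => //= n.
  by rewrite mulr_ge0// exprn_ge0// ltW.
rewrite /pseries_diffs mulrAC mulrC !normrM ler_wpM2l// normrX normr_nat.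
rewrite /r exprMn ler_pM//.
  by rewrite -natrX ler_nat; exact/ltnW/ltn_expl.
apply: (@le_trans _ _ ((`|x| + 1) ^+ n)); first by rewrite lerXn2r ?nnegrE ?addr_ge0// lerDl.
by rewrite ler_weXn2l// lerDr.
Qed.

Lemma is_derive_pseries c : (forall x, cvgn (pseries c x)) ->
  forall x, is_derive x 1 (fun y => limn (pseries c y))
    (limn (pseries (pseries_diffs c) x)).
Proof.
move=> cc x; apply: (@pseries_snd_diffs _ _ (`|x| + 1)) => //.
- exact: cvgn_pseries_diffs.
- by apply: cvgn_pseries_diffs; exact: cvgn_pseries_diffs.
- by rewrite [ltRHS]ger0_norm ?addr_ge0// ltrDl.
Qed.

Lemma limn_pseries0 c : limn (pseries c 0) = c 0%N.
Proof.
apply: lim_near_cst => //; near=> n.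
rewrite -[n]prednK; last by near: n; exact: nbhs_infty_gt.
rewrite /pseries /series/= big_nat_recl//= expr0 mulr1 big1 ?addr0// => i _.
by rewrite expr0n/= mulr0.
Unshelve. all: by end_near. Qed.

(** Evaluating at 0 kills the constant coefficient; the differentiated series
    also sums to 0, so induction reaches every coefficient. *)
Lemma pseries_eq0 c : (forall x, pseries c x @ \oo --> 0) -> forall n, c n = 0.
Proof.
move=> c0 n; elim: n c c0 => [|n ih] c c0.
  by rewrite -limn_pseries0; exact: cvg_lim.
have cc x : cvgn (pseries c x) by apply/cvg_ex; exists 0.
suff /eqP : pseries_diffs c n = 0 by rewrite mulf_eq0 pnatr_eq0 => /eqP.
apply: ih => x; have := is_derive_pseries cc x.
have -> : (fun y => limn (pseries c y)) = cst 0.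
  by apply/funext => y; exact: cvg_lim.
move=> D0; have <- : limn (pseries (pseries_diffs c) x) = 0.
  by case: D0 => _ <-; exact: derive_cst.
exact: cvgn_pseries_diffs.
Qed.

Lemma cvg_pseries_shift c x l : pseries c x @ \oo --> l ->
  pseries (fun n => if n is m.+1 then c m else 0) x @ \oo --> x * l.
Proof.
move=> cl; rewrite -cvg_shiftS.
rewrite [X in X @ _ --> _](_ : _ = fun n => x * pseries c x n).
  by apply: cvgM => //; exact: cvg_cst.
apply/funext => n; rewrite /pseries /series/= big_nat_recl//= mul0r add0r.
by rewrite big_distrr/=; apply: eq_bigr => i _; rewrite exprS mulrCA.
Qed.

(** For fixed x the generating function f satisfies f'(z) = (2x - 2z) f(z);
    comparing the coefficients of z ^ n on both sides gives the recurrence.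
    At n = 0 the predecessor n.-1 is again 0, but it is multiplied by 0. *)
Lemma hermite_rec (H : nat -> {poly R}) x : hermite_polynomials H ->
  (H 0%N).[x] = 1 /\
  forall n, (H n.+1).[x] = 2 * x * (H n).[x] - 2 * n%:R * (H n.-1).[x].
Proof.
move=> HH; pose a n := (H n).[x] / n`!%:R.
have aE z : pseries a z @ \oo --> expR (2 * x * z - z ^+ 2) by exact: HH.
have ac z : cvgn (pseries a z) by apply/cvg_ex; eexists; exact: aE.
have fE : (fun y => limn (pseries a y)) = (fun z => expR (2 * x * z - z ^+ 2)).
  by apply/funext => z; apply/cvg_lim => //; exact: aE.
split.
  have := limn_pseries0 a; have /(congr1 (fun f => f 0)) /= -> := fE.
  by rewrite expr0n/= mulr0 subr0 expR0 /a fact0 divr1.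
pose b n := if n is m.+1 then a m else 0.
(* [d] collects the coefficients of f' - (2x - 2z) f *)
pose d n := pseries_diffs a n - 2 * x * a n + 2 * b n.
have d0 n : d n = 0.
  move: n; apply: pseries_eq0 => z.
  set f := expR (2 * x * z - z ^+ 2).
  have f' : pseries (pseries_diffs a) z @ \oo --> (2 * x - 2 * z) * f.
    have := is_derive_pseries ac z; rewrite fE => -[_ E].
    have -> : (2 * x - 2 * z) * f = limn (pseries (pseries_diffs a) z).
      rewrite -E; apply/esym/derive_val.
      apply: is_derive_eq; rewrite /f/= /GRing.scale/=; ring.
    exact: cvgn_pseries_diffs.
  have cstE (k : R) : (fun _ : nat => k) @ \oo --> k by exact: cvg_cst.
  have := cvgD (cvgB f' (cvgM (cstE (2 * x)) (aE z)))
     (cvgM (cstE 2) (cvg_pseries_shift (aE z))).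
  rewrite -/f (_ : (2 * x - 2 * z) * f - 2 * x * f + 2 * (z * f) = 0); last ring.
  move=> /(_ _ _ _ _); set g := (X in X @ _ --> _) => gl.
  suff -> : pseries d z = g by exact: gl.
  apply/funext => n; rewrite {gl}/g.
  rewrite !fctE /pseries /series/=. rewrite !mulr_sumr -sumrB -big_split/=.
  by apply: eq_bigr => i _; rewrite /d/= -/(b i); ring.
move=> n; have := d0 n; rewrite /d /b /pseries_diffs /a.
have nf m : (m`!%:R : R) != 0 by rewrite pnatr_eq0 -lt0n fact_gt0.
have n1 m : (m.+1%:R : R) != 0 by rewrite pnatr_eq0.
case: n => [|n]/=.
  by rewrite !fact0 mulr0 !divr1 mul1r addr0 => /subr0_eq ->; ring.
rewrite !factS !natrM => E.
apply/eqP; rewrite -subr_eq0; apply/eqP.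
rewrite -[RHS](mulr0 (n.+1%:R * n`!%:R)) -{}E.
by field; rewrite nf nat1r -natrD !pnatr_eq0.
Qed.

End power_series.

(** * Complex differentiability in terms of real and imaginary parts *)
Section complex_topology.
Context {R : realType}.
Implicit Types (z w : R[i]).
Import ComplexField.Normc.

Lemma Re_add z w : complex.Re (z + w) = complex.Re z + complex.Re w.
Proof. by case: z w => [a b] []. Qed.

Lemma Im_add z w : complex.Im (z + w) = complex.Im z + complex.Im w.
Proof. by case: z w => [a b] []. Qed.

Lemma Re_opp z : complex.Re (- z) = - complex.Re z.
Proof. by case: z. Qed.

Lemma Im_opp z : complex.Im (- z) = - complex.Im z.
Proof. by case: z. Qed.

Lemma Re_mul z w : complex.Re (z * w) =
  complex.Re z * complex.Re w - complex.Im z * complex.Im w.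
Proof. by case: z w => [a b] []. Qed.

Lemma Im_mul z w : complex.Im (z * w) =
  complex.Re z * complex.Im w + complex.Im z * complex.Re w.
Proof. by case: z w => [a b] []. Qed.

Definition ReIm_add := (Re_add, Im_add, Re_opp, Im_opp).

Lemma le_Re_normc z : `|complex.Re z| <= normc z.
Proof.
by case: z => a b /=; rewrite -sqrtr_sqr ler_wsqrtr// lerDl sqr_ge0.
Qed.

Lemma le_Im_normc z : `|complex.Im z| <= normc z.
Proof.
by case: z => a b /=; rewrite -sqrtr_sqr ler_wsqrtr// lerDr sqr_ge0.
Qed.

Lemma normc_le_ReIm z : normc z <= `|complex.Re z| + `|complex.Im z|.
Proof.
case: z => a b /=; rewrite -[leRHS]ger0_norm ?addr_ge0// -sqrtr_sqr ler_wsqrtr//.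
rewrite sqrrD -!normrX !(ger0_norm (sqr_ge0 _)) lerD2r lerDl.
by rewrite mulrn_wge0// mulr_ge0.
Qed.

Lemma normc_ge0 z : 0 <= normc z.
Proof. by case: z => a b; exact: sqrtr_ge0. Qed.

(** A positive element of [R[i]] is real, so its real part carries all the
    information; this turns the [R[i]]-valued norm into a real one. *)
Lemma normc_lt_C z (e : R[i]) : 0 < e -> (`|z| < e) = (normc z < complex.Re e).
Proof. by case: e => a b; rewrite ltcE/= => /andP[/eqP-> _]; rewrite normc_def ltcR; case: z. Qed.

Lemma cvg_complex {T : Type} (F : set_system T) {FF : Filter F} (f : T -> R[i])
    (l : R[i]) :
  complex.Re (f x) @[x --> F] --> complex.Re l ->
  complex.Im (f x) @[x --> F] --> complex.Im l ->
  f @ F --> (l : R[i]^o).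
Proof.
move=> /cvgrPdist_lt fRe /cvgrPdist_lt fIm.
apply/(@cvgrPdist_lt _ (R[i]^o)) => e e0.
have e2 : 0 < complex.Re e / 2 by move: e0; rewrite ltcE => /andP[_ ?]; rewrite divr_gt0.
near=> x; rewrite normc_lt_C//.
apply: (le_lt_trans (normc_le_ReIm _)); rewrite !ReIm_add.
rewrite [ltRHS]splitr ltrD//.
- by near: x; exact: fRe.
- by near: x; exact: fIm.
Unshelve. all: by end_near. Qed.

(** Multiplying the difference quotient by h removes the division and the
    exclusion of h = 0; real estimates can then be used directly. *)
Lemma derivable_complexP (F : R[i] -> R[i]) z :
  derivable (F : R[i]^o -> R[i]^o) z 1 <->
  exists l : R[i], forall e : R, 0 < e -> exists2 d : R, 0 < d &
    forall h, normc h < d -> normc (F (z + h) - F z - l * h) <= e * normc h.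
Proof.
split.
  move=> /cvg_ex[l /(@cvgrPdist_lt _ (R[i]^o)) Fl]; exists l => e e0.
  have := Fl e%:C; rewrite ltcR => /(_ e0)/nbhs_ballP[d /= d0 dF].
  exists (complex.Re d); first by move: d0; rewrite ltcE => /andP[].
  move=> h hd; have [->|h0] := eqVneq h 0.
    by rewrite addr0 mulr0 !subrr normc0 mulr0.
  have := dF h; rewrite /ball/= sub0r normrN normc_lt_C// => /(_ hd h0).
  rewrite normc_lt_C ?ltcR//= [h%:A]mulr1 (addrC h) => /ltW.
  move=> /(ler_wpM2r (normc_ge0 h)); rewrite -normcM.
  rewrite [_ *: _]mulrC mulrBl mulfVK// -[normc (l * h - _)]normcN.
  by rewrite opprB.
move=> [l lF]; apply/cvg_ex; exists l; apply/(@cvgrPdist_lt _ (R[i]^o)) => e e0.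
have e2 : 0 < complex.Re e / 2 by move: e0; rewrite ltcE => /andP[_ ?]; rewrite divr_gt0.
have [d d0 dF] := lF _ e2.
apply/nbhs_ballP; exists d%:C => /=; first by rewrite ltcR.
move=> h; rewrite /ball/= sub0r normrN normc_lt_C ?ltcR//= => hd h0.
rewrite normc_lt_C// [h%:A]mulr1 (addrC h).
have n0 : 0 < normc h.
  by rewrite lt_neqAle normc_ge0 andbT eq_sym; apply: contra_neq h0; exact: eq0_normc.
rewrite -(ltr_pM2r n0) -normcM (le_lt_trans _ (_ : complex.Re e / 2 * normc h < _))//.
  have := dF h hd; rewrite [_ *: _]mulrC mulrBl mulfVK// -[normc (l * h - _)]normcN.
  by rewrite opprB.
by rewrite ltr_pM2r//; move: e2; lra.
Qed.

End complex_topology.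

(** * The complex exponential is entire *)
Section complex_exponential.
Context {R : realType}.
Implicit Types (z w : R[i]).
Import ComplexField.Normc.

Lemma is_derive_eps (f : R -> R) (x l : R) : is_derive x 1 f l ->
  forall e : R, 0 < e -> exists2 d : R, 0 < d &
    forall h : R, `|h| < d -> `|f (x + h) - f x - l * h| <= e * `|h|.
Proof.
move=> [df <-] e e0; have /cvgrPdist_le/(_ _ e0)/nbhs_ballP[d /= d0 dF] := df.
exists d => // h hd; have [->|h0] := eqVneq h 0.
  by rewrite addr0 subrr mulr0 subrr normr0 mulr0.
have := dF h; rewrite /ball/= sub0r normrN => /(_ hd h0).
rewrite [h%:A]mulr1 (addrC h) distrC => /(ler_wpM2r (normr_ge0 h)).
rewrite -normrM; congr (`|_| <= _).
by rewrite [_ *: _]mulrC mulrBl mulfVK.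
Qed.

Lemma cexpD z w : cexp (z + w) = cexp z * cexp w.
Proof.
case: z w => [a b] [c d]; rewrite /cexp/= expRD cosD sinD; simpc.
by congr (_ +i* _); ring.
Qed.

Lemma conj_cexp z : conjc (cexp z) = cexp (conjc z).
Proof. by case: z => a b; rewrite /cexp/= cosN sinN; simpc. Qed.

Lemma normc_cexp z : normc (cexp z) = expR (complex.Re z).
Proof.
rewrite /cexp normcM /= cos2Dsin2 sqrtr1 mulr1 expr0n addr0 sqrtr_sqr.
by rewrite ger0_norm// expR_ge0.
Qed.

Lemma cexp_real (x : R) : cexp x%:C = (expR x)%:C.
Proof. by rewrite /cexp/= cos0 sin0; simpc. Qed.

(** With h = a + ib, the real and imaginary parts of exp h - 1 - h are
      (e^a - 1 - a) cos b + (1 + a) (cos b - 1)  and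
      (e^a - 1) sin b + (sin b - b),
    so the claim follows from the first-order expansions of the real functions
    exp, cos and sin at 0. *)
Lemma cexp_near0 (e : R) : 0 < e -> exists2 d : R, 0 < d &
  forall h : R[i], normc h < d -> normc (cexp h - 1 - h) <= e * normc h.
Proof.
move=> e0.
(* the errors below add up to at most [8 * r * normc h] *)
have [r [r0 re r1]] : exists r : R, [/\ 0 < r, r <= e / 8 & r <= 1].
  by exists (Num.min (e / 8) 1); rewrite lt_min !ge_min !lexx orbT divr_gt0 ?ltr01.
have [d1 d10 E] := is_derive_eps (is_derive_expR 0) r0.
have [d2 d20 C] := is_derive_eps (is_derive_cos 0) r0.
have [d3 d30 S] := is_derive_eps (is_derive_sin 0) r0.
exists (Num.min r (Num.min d1 (Num.min d2 d3))); first by rewrite !lt_min r0 d10 d20 d30.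
move=> h; rewrite !lt_min => /and4P[hr h1 h2 h3].
have := le_Re_normc h; have := le_Im_normc h; have := normc_ge0 h.
have /E := le_lt_trans (le_Re_normc h) h1.
have /C := le_lt_trans (le_Im_normc h) h2.
have /S := le_lt_trans (le_Im_normc h) h3.
rewrite !add0r expR0 cos0 sin0 !mul1r !subr0 oppr0 mul0r subr0.
set n := normc h in hr *.
rewrite /n => + + + _ _ _; rewrite -/n.
move: (le_Re_normc h) (le_Im_normc h) (normc_ge0 h); rewrite -/n.
case: h @n {h1 h2 h3} hr => a b n hr; rewrite -/n.
rewrite [complex.Re _]/= [complex.Im _]/= => an bn n0 Sb Cb Ea.
have {}Sb : `|sin b - b| <= r * n by rewrite (le_trans Sb)// ler_pM2l.
have {}Cb : `|cos b - 1| <= r * n by rewrite (le_trans Cb)// ler_pM2l.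
have {}Ea : `|expR a - 1 - a| <= r * n by rewrite (le_trans Ea)// ler_pM2l.
have n1 : n <= 1 by rewrite (le_trans (ltW hr)).
have rn : r * n <= n by rewrite ler_piMl.
have sb : `|sin b| <= 2 * n.
  rewrite -(subrK b (sin b)) (le_trans (ler_normD _ _))//; lra.
have ea : `|expR a - 1| <= 2 * n.
  rewrite -(subrK a (expR a - 1)) (le_trans (ler_normD _ _))//; lra.
have -> : cexp (a +i* b) - 1 - (a +i* b) =
  (((expR a - 1 - a) * cos b + (1 + a) * (cos b - 1)) +i*
   ((expR a - 1) * sin b + (sin b - b))).
  by rewrite /cexp/= -[1]/(1%:C); simpc; congr (_ +i* _); ring.
rewrite (le_trans (normc_le_ReIm _))//=.
have E1 : `|(expR a - 1 - a) * cos b| <= r * n.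
  by rewrite normrM -[leRHS]mulr1 ler_pM// ler_norml cos_geN1 cos_le1.
have E2 : `|(1 + a) * (cos b - 1)| <= 2 * (r * n).
  rewrite normrM ler_pM// (le_trans (ler_normD _ _))// normr1; lra.
have E3 : `|(expR a - 1) * sin b| <= 4 * (r * n).
  rewrite normrM (le_trans (ler_pM _ _ ea sb))//.
  have : n * n <= r * n by rewrite ler_wpM2r// ltW.
  lra.
have := ler_normD ((expR a - 1 - a) * cos b) ((1 + a) * (cos b - 1)).
have := ler_normD ((expR a - 1) * sin b) (sin b - b).
have : 8 * (r * n) <= e * n.
  by rewrite mulrA ler_wpM2r//; move: re; rewrite ler_pdivlMr// mulrC.
lra.
Qed.

Lemma entire_cexp : entire (@cexp R).
Proof.
move=> z; apply/derivable_complexP; exists (cexp z) => e e0.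
have n0 : 0 < normc (cexp z) + 1 by rewrite ltr_wpDl ?normc_ge0.
have [d d0 dh] := cexp_near0 (divr_gt0 e0 n0).
exists d => // h /dh hd.
have -> : cexp (z + h) - cexp z - cexp z * h = cexp z * (cexp h - 1 - h).
  by rewrite cexpD; ring.
rewrite normcM (le_trans (ler_wpM2l (normc_ge0 _) hd))//.
rewrite mulrA ler_wpM2r ?normc_ge0// mulrCA ger_pMr//.
by rewrite ler_pdivrMr// mul1r lerDl.
Qed.

Lemma entireM (F G : R[i] -> R[i]) : entire F -> entire G ->
  entire (fun z => F z * G z).
Proof. by move=> eF eG z; apply: derivableM; [exact: eF|exact: eG]. Qed.

Lemma entireB (F G : R[i] -> R[i]) : entire F -> entire G ->
  entire (fun z => F z - G z).
Proof. by move=> eF eG z; apply: derivableB; [exact: eF|exact: eG]. Qed.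

Lemma entire_cst (c : R[i]) : entire (fun=> c).
Proof. by move=> z; exact: derivable_cst. Qed.

Lemma entire_id : entire (@id R[i]).
Proof. by move=> z; exact: derivable_id. Qed.

Lemma entireX (F : R[i] -> R[i]) n : entire F -> entire (fun z => F z ^+ n).
Proof.
move=> eF; elim: n => [|n ih]; first exact: entire_cst.
rewrite [X in entire X](_ : _ = fun z => F z * F z ^+ n); first exact: entireM.
by apply/funext => z; rewrite exprS.
Qed.

Lemma entire_comp (F G : R[i] -> R[i]) : entire F -> entire G -> entire (F \o G).
Proof.
move=> eF eG z; apply/derivable1_diffP.
apply: (@differentiable_comp _ R[i]^o R[i]^o R[i]^o G F).
  exact/derivable1_diffP/eG.
exact/derivable1_diffP/eF.
Qed.

End complex_exponential.

(** * The exponential series over the complex numbers *)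
Section complex_exponential_series.
Context {R : realType}.
Import ComplexField.Normc.

Lemma normcX (z : R[i]) n : normc (z ^+ n) = normc z ^+ n.
Proof.
by elim: n => [|n ih]; rewrite ?expr0 ?normc1// !exprS normcM ih.
Qed.

Lemma cvgn_exp_bounded (z : R[i]) (f : R[i] -> R) :
  (forall w, `|f w| <= normc w) ->
  forall t, cvgn (pseries (fun n => f (z ^+ n) / n`!%:R) t).
Proof.
move=> fN t; apply: normed_cvg.
apply: series_le_cvg (is_cvg_series_exp_coeff (normc z * `|t|)) => /= n; first exact: normr_ge0.
  by rewrite exp_coeff_ge0// mulr_ge0// normc_ge0.
rewrite /exp_coeff/= !normrM normrX exprMn mulrAC normfV normr_nat.
by rewrite ler_wpM2r// ?invr_ge0// ler_wpM2r ?exprn_ge0// -normcX.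
Qed.

(** Along the ray t z with z = a + ib, the real and imaginary parts C, S of the
    series are real power series in t with C' = aC - bS and S' = bC + aS.
    Hence e^(-ta) (cos tb - i sin tb) (C + iS) has zero derivative; it is 1 at
    t = 0, and t = 1 is the claim. *)
Lemma cvg_cexp (z : R[i]) :
  series (fun n => z ^+ n / n`!%:R) @ \oo --> (cexp z : R[i]^o).
Proof.
pose C n := complex.Re (z ^+ n) / n`!%:R.
pose S n := complex.Im (z ^+ n) / n`!%:R.
have Cc t : cvgn (pseries C t) by apply: cvgn_exp_bounded; exact: le_Re_normc.
have Sc t : cvgn (pseries S t) by apply: cvgn_exp_bounded; exact: le_Im_normc.
pose fC (t : R) : R := limn (pseries C t).
pose fS (t : R) : R := limn (pseries S t).
have CE t : pseries C t @ \oo --> fC t by exact: Cc.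
have SE t : pseries S t @ \oo --> fS t by exact: Sc.
pose a := complex.Re z; pose b := complex.Im z.
have dcoef (p q r : R ^nat) (k l : R) : (forall n, p n = k * q n + l * r n) ->
    (forall t, cvgn (pseries q t)) -> (forall t, cvgn (pseries r t)) ->
    forall t, limn (pseries p t) = k * limn (pseries q t) + l * limn (pseries r t).
  move=> pE qc rc t; apply/cvg_lim => //.
  have cstE (u : R) : (fun _ : nat => u) @ \oo --> u by exact: cvg_cst.
  suff E : pseries p t =1 (fun=> k) \* pseries q t + (fun=> l) \* pseries r t.
    by rewrite (eq_cvg _ _ E); apply: cvgD; exact: cvgM.
  move=> n; apply: esym; rewrite !fctE /pseries /series/= !mulr_sumr -big_split/=.
  by apply: eq_bigr => i _; rewrite pE; ring.
have fact0' n : (n`!%:R : R) != 0 by rewrite pnatr_eq0 -lt0n fact_gt0.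
have dC (t : R) : is_derive t 1 fC (a * fC t + (- b) * fS t).
  rewrite -(dcoef (pseries_diffs C)) //; first exact: is_derive_pseries.
  move=> n; rewrite /pseries_diffs /C /S exprS Re_mul factS natrM -/a -/b.
  by field; rewrite fact0' nat1r pnatr_eq0.
have dS (t : R) : is_derive t 1 fS (b * fC t + a * fS t).
  rewrite -(dcoef (pseries_diffs S)) //; first exact: is_derive_pseries.
  move=> n; rewrite /pseries_diffs /C /S exprS Im_mul factS natrM -/a -/b.
  by field; rewrite fact0' nat1r pnatr_eq0.
pose e (t : R) := expR (- t * a); pose c (t : R) := cos (t * b); pose s (t : R) := sin (t * b).
have de (t : R) : is_derive t 1 e (- a * e t).
  by apply: is_derive_eq; rewrite /e /GRing.scale/=; ring.
have dc (t : R) : is_derive t 1 c (- b * s t).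
  by apply: is_derive_eq; rewrite /s /GRing.scale/=; ring.
have ds (t : R) : is_derive t 1 s (b * c t).
  by apply: is_derive_eq; rewrite /c /GRing.scale/=; ring.
(* real and imaginary parts of the constant function *)
have g1 : e 1 * (c 1 * fC 1 + s 1 * fS 1) = e 0 * (c 0 * fC 0 + s 0 * fS 0).
  apply: (@is_derive_0_is_cst _ (fun t => e t * (c t * fC t + s t * fS t))) => t.
  by apply: is_derive_eq; rewrite /GRing.scale/=; ring.
have g2 : e 1 * (c 1 * fS 1 - s 1 * fC 1) = e 0 * (c 0 * fS 0 - s 0 * fC 0).
  apply: (@is_derive_0_is_cst _ (fun t => e t * (c t * fS t - s t * fC t))) => t.
  by apply: is_derive_eq; rewrite /GRing.scale/=; ring.
have fC0 : fC 0 = 1 by rewrite /fC limn_pseries0 /C fact0 expr0 divr1.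
have fS0 : fS 0 = 0 by rewrite /fS limn_pseries0 /S fact0 expr0 divr1.
move: g1 g2; rewrite fC0 fS0 /e /c /s oppr0 !mul0r expR0 cos0 sin0 !mulr1 !mulr0.
rewrite subrr !addr0 mulr1 !mul1r mulN1r => g1 g2.
have cs := cos2Dsin2 b.
have ea : expR a * expR (- a) = 1 by rewrite expRxMexpNx_1.
have f1 : fC 1 = expR a * cos b.
  transitivity (expR a * (cos b * (expR (- a) * (cos b * fC 1 + sin b * fS 1)) -
      sin b * (expR (- a) * (cos b * fS 1 - sin b * fC 1)))).
    transitivity ((expR a * expR (- a)) * (cos b ^+ 2 + sin b ^+ 2) * fC 1); last ring.
    by rewrite ea cs !mul1r.
  by rewrite g1 g2; ring.
have f2 : fS 1 = expR a * sin b.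
  transitivity (expR a * (sin b * (expR (- a) * (cos b * fC 1 + sin b * fS 1)) +
      cos b * (expR (- a) * (cos b * fS 1 - sin b * fC 1)))).
    transitivity ((expR a * expR (- a)) * (cos b ^+ 2 + sin b ^+ 2) * fS 1); last ring.
    by rewrite ea cs !mul1r.
  by rewrite g1 g2; ring.
have divE (w : R[i]) n : w / n`!%:R = w * ((n`!%:R : R)^-1)%:C.
  by rewrite -(rmorph_nat (real_complex R)) -fmorphV.
apply: cvg_complex.
  have -> : complex.Re (cexp z) = fC 1 by rewrite f1 /cexp; simpc.
  suff -> : (fun n => complex.Re (series (fun n => z ^+ n / n`!%:R) n)) = pseries C 1.
    exact: CE.
  apply/funext; elim => [|n ih]; first by rewrite /pseries /series/= !big_geq.
  rewrite /pseries !seriesSr Re_add ih; congr (_ + _).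
  by rewrite divE Re_mul/= mulr0 subr0 expr1n mulr1.
have -> : complex.Im (cexp z) = fS 1 by rewrite f2 /cexp; simpc.
suff -> : (fun n => complex.Im (series (fun n => z ^+ n / n`!%:R) n)) = pseries S 1.
  exact: SE.
apply/funext; elim => [|n ih]; first by rewrite /pseries /series/= !big_geq.
rewrite /pseries !seriesSr Im_add ih; congr (_ + _).
by rewrite divE Im_mul/= mulr0 add0r expr1n mulr1.
Qed.

End complex_exponential_series.

(** * Integrals of continuous functions over segments *)
Section segment_integral.
Context {R : realType}.
Notation mu := (@lebesgue_measure R).
Implicit Types (f g : R -> R).

Lemma integrable_continuous_segment f (a b : R) : continuous f ->
  mu.-integrable `[a, b] (EFin \o f).
Proof.
move=> cf; apply: continuous_compact_integrable; first exact: segment_compact.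
exact: continuous_subspaceT.
Qed.

Lemma Rintegral_segment_cat f (a b c : R) : continuous f -> a <= c -> c <= b ->
  \int[mu]_(x in `[a, b]) f x =
  \int[mu]_(x in `[a, c]) f x + \int[mu]_(x in `[c, b]) f x.
Proof.
move=> cf ac cb; apply/eqP; rewrite addrC -subr_eq; apply/eqP.
rewrite (Rintegral_itvB (integrable_continuous_segment a b cf)) ?bnd_simp//.
rewrite Rintegral_itv_obnd_cbnd//.
apply: integrableS (integrable_continuous_segment c b cf) => //.
by apply: subset_itvr; rewrite bnd_simp.
Qed.

Lemma Rintegral_segment_cst (a b k : R) : a <= b ->
  \int[mu]_(x in `[a, b]) k = k * (b - a).
Proof.
move=> ab; rewrite Rintegral_cst//; congr (_ * _).
rewrite /= (lebesgue_measure_itv `[a, b])/= lte_fin; case: ltgtP ab => //= -> _; by rewrite subrr.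
Qed.

Lemma Rintegral_segment_near f (a b k e : R) : continuous f -> a <= b ->
  (forall x, a <= x <= b -> `|f x - k| <= e) ->
  `|\int[mu]_(x in `[a, b]) f x - k * (b - a)| <= e * (b - a).
Proof.
move=> cf ab fk; rewrite -!Rintegral_segment_cst//.
have ck (c : R) : continuous (fun _ : R => c) by move=> x; exact: cvg_cst.
rewrite -RintegralB//; [|exact: integrable_continuous_segment..].
apply: (le_trans (le_normr_Rintegral _ _)) => //.
  by apply: integrable_continuous_segment => x; apply: cvgB; [exact: cf|exact: cvg_cst].
apply: le_Rintegral => //.
- apply: integrable_continuous_segment => x; apply: cvg_norm.
  by apply: cvgB; [exact: cf|exact: cvg_cst].
- exact: integrable_continuous_segment.
Qed.

Lemma Rintegral_segment_ge f (a b k : R) : continuous f -> a <= b ->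
  (forall x, a <= x <= b -> k <= f x) ->
  k * (b - a) <= \int[mu]_(x in `[a, b]) f x.
Proof.
move=> cf ab fk; rewrite -Rintegral_segment_cst//.
apply: le_Rintegral => //; try exact: integrable_continuous_segment.
by apply: (@integrable_continuous_segment (fun _ : R => k)) => x; exact: cvg_cst.
Qed.

End segment_integral.

(** * Goursat's theorem on rectangles *)
Section Goursat.
Context {R : realType}.
Notation mu := (@lebesgue_measure R).
Variables P Q : R -> R -> R.
Hypothesis cP : forall y, continuous (P^~ y).
Hypothesis cQ : forall x, continuous (Q x).

(** The circulation of P dx + Q dy around the rectangle [a, b] x [c, d],
    counterclockwise.  Opposite sides are grouped, so that only increments of P
    and Q across the rectangle enter the estimates. *)
Definition loop_integral (a b c d : R) : R :=
  \int[mu]_(x in `[a, b]) (P x c - P x d) + \int[mu]_(y in `[c, d]) (Q b y - Q a y).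

Let cPB c d : continuous (fun x => P x c - P x d).
Proof. by move=> x; apply: cvgB; exact: cP. Qed.

Let cQB a b : continuous (fun y => Q b y - Q a y).
Proof. by move=> x; apply: cvgB; exact: cQ. Qed.

Lemma loop_integral_splitx (a m b c d : R) : a <= m -> m <= b ->
  loop_integral a b c d = loop_integral a m c d + loop_integral m b c d.
Proof.
move=> am mb; rewrite /loop_integral (Rintegral_segment_cat (@cPB c d) am mb).
rewrite addrACA; congr (_ + _).
rewrite -RintegralD//; [|exact: integrable_continuous_segment..].
by apply: eq_Rintegral => y _; ring.
Qed.

Lemma loop_integral_splity (a b c m d : R) : c <= m -> m <= d ->
  loop_integral a b c d = loop_integral a b c m + loop_integral a b m d.
Proof.
move=> cm md; rewrite /loop_integral (Rintegral_segment_cat (@cQB a b) cm md).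
rewrite addrACA; congr (_ + _).
rewrite -RintegralD//; [|exact: integrable_continuous_segment..].
by apply: eq_Rintegral => y _; ring.
Qed.

(** The common coefficient q (that is, P_y = Q_x) makes the linear parts of
    the two grouped integrals cancel; constants and the coefficients p, s drop
    out of the increments.  Only the error term remains, of second order in the
    perimeter. *)
Lemma loop_integral_small (a b c d x0 y0 p q s e : R) :
  0 <= e -> a <= x0 <= b -> c <= y0 <= d ->
  (forall x y, a <= x <= b -> c <= y <= d ->
    `|P x y - P x0 y0 - (p * (x - x0) + q * (y - y0))| <= e * (`|x - x0| + `|y - y0|) /\
    `|Q x y - Q x0 y0 - (q * (x - x0) + s * (y - y0))| <= e * (`|x - x0| + `|y - y0|)) ->
  `|loop_integral a b c d| <= 2 * e * ((b - a) + (d - c)) ^+ 2.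
Proof.
move=> e0 x0ab y0cd H; pose L := (b - a) + (d - c).
have ab : a <= b by move: x0ab => /andP[]; exact: le_trans.
have cd : c <= d by move: y0cd => /andP[]; exact: le_trans.
have ca : a <= a <= b by rewrite lexx.
have cb : a <= b <= b by rewrite lexx andbT.
have cc : c <= c <= d by rewrite lexx.
have cdd : c <= d <= d by rewrite lexx andbT.
have dist (u v t r : R) : u <= t <= v -> u <= r <= v -> `|t - r| <= v - u.
  by move=> /andP[? ?] /andP[? ?]; rewrite ler_norml; lra.
have near x y : a <= x <= b -> c <= y <= d -> e * (`|x - x0| + `|y - y0|) <= e * L.
  by move=> hx hy; rewrite ler_wpM2l// lerD// dist.
have EP : `|\int[mu]_(x in `[a, b]) (P x c - P x d) - q * (c - d) * (b - a)|
    <= 2 * (e * L) * (b - a).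
  apply: Rintegral_segment_near => // x hx.
  have [H1 _] := H _ _ hx cc; have [H2 _] := H _ _ hx cdd.
  have := near _ _ hx cc; have := near _ _ hx cdd.
  move: H1 H2; rewrite !ler_norml; lra.
have EQ : `|\int[mu]_(y in `[c, d]) (Q b y - Q a y) - q * (b - a) * (d - c)|
    <= 2 * (e * L) * (d - c).
  apply: Rintegral_segment_near => // y hy.
  have [_ H1] := H _ _ ca hy; have [_ H2] := H _ _ cb hy.
  have := near _ _ ca hy; have := near _ _ cb hy.
  move: H1 H2; rewrite !ler_norml; lra.
have -> : 2 * e * L ^+ 2 = 2 * (e * L) * (b - a) + 2 * (e * L) * (d - c).
  by rewrite /L; ring.
apply: le_trans (lerD EP EQ); apply: le_trans (ler_normD _ _).
by rewrite le_eqVlt; apply/orP; left; apply/eqP; congr `|_|; rewrite /loop_integral; ring.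
Qed.

Hypothesis PQ_closed : forall x0 y0, exists p q s : R,
  forall e : R, 0 < e -> exists2 d : R, 0 < d & forall x y,
    `|x - x0| < d -> `|y - y0| < d ->
    `|P x y - P x0 y0 - (p * (x - x0) + q * (y - y0))| <= e * (`|x - x0| + `|y - y0|) /\
    `|Q x y - Q x0 y0 - (q * (x - x0) + s * (y - y0))| <= e * (`|x - x0| + `|y - y0|).

(** Goursat's argument: if the circulation were K <> 0, bisecting both sides
    n times leaves a rectangle with circulation at least K / 4 ^ n.  These
    rectangles shrink to a point (x0, y0), where differentiability makes the
    circulation o(4 ^ -n). *)
Lemma loop_integral_eq0 (a b c d : R) : a <= b -> c <= d -> loop_integral a b c d = 0.
Proof.
move=> ab cd; pose A := b - a; pose C := d - c.
have A0 : 0 <= A by rewrite subr_ge0.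
have C0 : 0 <= C by rewrite subr_ge0.
pose K := `|loop_integral a b c d|.
pose r n : R := 2^-1 ^+ n.
have r0 n : 0 < r n by rewrite exprn_gt0.
have rS n : r n = r n.+1 + r n.+1 by rewrite /r exprS; lra.
pose bad n (u : R * R) :=
  K * r n ^+ 2 <= `|loop_integral u.1 (u.1 + r n * A) u.2 (u.2 + r n * C)|.
pose close n (u v : R * R) :=
  u.1 <= v.1 <= u.1 + r n.+1 * A /\ u.2 <= v.2 <= u.2 + r n.+1 * C.
have step n u : bad n u -> exists v, bad n.+1 v /\ close n u v.
  case: u => x y; rewrite /bad/close/= => bu.
  pose h := r n.+1 * A; pose k := r n.+1 * C.
  have h0 : 0 <= h by rewrite mulr_ge0// ltW.
  have k0 : 0 <= k by rewrite mulr_ge0// ltW.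
  have nh : r n * A = h + h by rewrite rS mulrDl.
  have nk : r n * C = k + k by rewrite rS mulrDl.
  apply: contrapT => /forallNP nv.
  have small v : x <= v.1 <= x + h -> y <= v.2 <= y + k ->
      `|loop_integral v.1 (v.1 + h) v.2 (v.2 + k)| < K * r n.+1 ^+ 2.
    by move=> hv kv; rewrite ltNge; apply/negP => ?; exact: (nv v).
  have s1 := small (x, y); have s2 := small (x + h, y).
  have s3 := small (x, y + k); have s4 := small (x + h, y + k).
  rewrite /= in s1 s2 s3 s4.
  have hx : x <= x + h by rewrite lerDl.
  have ky : y <= y + k by rewrite lerDl.
  have {}s1 := s1 _ _; have {}s2 := s2 _ _.
  have {}s3 := s3 _ _; have {}s4 := s4 _ _.
  move: bu; rewrite nh nk !addrA.
  rewrite (@loop_integral_splitx x (x + h) (x + h + h))// ?lerDl//.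
  rewrite !(@loop_integral_splity _ _ y (y + k) (y + k + k)) ?lerDl//.
  apply/negP; rewrite -ltNge.
  apply: (le_lt_trans (ler_normD _ _)).
  have -> : r n = 2 * r n.+1 by rewrite rS; ring.
  have := ler_normD (loop_integral x (x + h) y (y + k))
    (loop_integral x (x + h) (y + k) (y + k + k)).
  have := ler_normD (loop_integral (x + h) (x + h + h) y (y + k))
    (loop_integral (x + h) (x + h + h) (y + k) (y + k + k)).
  move: s1 s2 s3 s4; rewrite !lexx hx ky.
  move=> /(_ isT isT) + /(_ isT isT) + /(_ isT isT) + /(_ isT isT).
  lra.
pose u := fix u n : R * R := if n is m.+1 then
  xget (u m) [set v | bad m.+1 v /\ close m (u m) v] else (a, c).
have ubad n : bad n (u n).
  elim: n => [|n ih]; last by have [] := xgetPex (u n) (step _ _ ih).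
  by rewrite /bad/= /r expr0 !mul1r expr1n mulr1 /A /C !(addrC _ (_ - _)) !subrK.
have uclose n : close n (u n) (u n.+1) by have [] := xgetPex (u n) (step _ _ (ubad n)).
(* nested intervals: the supremum of the left ends lies in all of them *)
have sup_in (x : R ^nat) (B : R) : 0 <= B ->
    (forall n, x n <= x n.+1 <= x n + r n.+1 * B) ->
    exists x0, forall n, x n <= x0 <= x n + r n * B.
  move=> B0 xB.
  have xup m n : (n <= m)%N -> x n <= x m.
    elim: m => [|m ih]; first by rewrite leqn0 => /eqP ->.
    rewrite leq_eqVlt => /predU1P[->//|]; rewrite ltnS => /ih /le_trans; apply.
    by have /andP[] := xB m.
  have xdn m n : (n <= m)%N -> x m + r m * B <= x n + r n * B.
    elim: m => [|m ih]; first by rewrite leqn0 => /eqP ->.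
    rewrite leq_eqVlt => /predU1P[->//|]; rewrite ltnS => /ih; apply: le_trans.
    have /andP[_ xm] := xB m.
    have -> : r m * B = r m.+1 * B + r m.+1 * B by rewrite -mulrDl -rS.
    by rewrite addrA lerD2r.
  have xx m n : x m <= x n + r n * B.
    have [mn|/ltnW nm] := leqP m n.
      by rewrite (le_trans (xup _ _ mn))// lerDl mulr_ge0// ltW.
    by apply: le_trans (xdn _ _ nm); rewrite lerDl mulr_ge0// ltW.
  exists (sup (range x)) => n; apply/andP; split.
    by apply: ub_le_sup; [exists (x n + r n * B) => _ [m _ <-]; exact: xx|exists n].
  by apply: ge_sup; [exists (x 0%N), 0%N|move=> _ [m _ <-]; exact: xx].
have [x0 x0P] := sup_in (fun n => (u n).1) A A0 (fun n => proj1 (uclose n)).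
have [y0 y0P] := sup_in (fun n => (u n).2) C C0 (fun n => proj2 (uclose n)).
have [p [q [s Hpq]]] := PQ_closed x0 y0.
apply/eqP; rewrite -normr_eq0; apply/negPn/negP => Kneq0.
have K0 : 0 < K by rewrite lt_neqAle eq_sym Kneq0 normr_ge0.
(* the 1 keeps [L] positive when the rectangle is degenerate *)
pose L := A + C + 1.
have L0 : 0 < L by rewrite /L; lra.
(* makes the bound of [loop_integral_small] half of [K * r n ^+ 2] *)
pose e := K / (4 * L ^+ 2).
have e0 : 0 < e by rewrite divr_gt0// mulr_gt0// exprn_gt0.
have [t t0 Ht] := Hpq e e0.
have [n nt] : exists n, r n * L < t.
  have : (fun n => r n * L) @ \oo --> 0.
    rewrite -[X in _ --> X](mul0r L); apply: cvgM; last exact: cvg_cst.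
    by apply: cvg_expr; rewrite ger0_norm//; lra.
  move=> /cvgrPdist_lt/(_ _ t0) [n _ /(_ n (leqnn n))]; rewrite sub0r normrN => nt.
  by exists n; apply: le_lt_trans nt; exact: ler_norm.
have /= := ubad n; apply/negP; rewrite -ltNge.
have rA : 0 <= r n * A by rewrite mulr_ge0// ltW.
have rC : 0 <= r n * C by rewrite mulr_ge0// ltW.
have rAL : r n * A <= r n * L by rewrite ler_wpM2l ?(ltW (r0 n))// /L; lra.
have rCL : r n * C <= r n * L by rewrite ler_wpM2l ?(ltW (r0 n))// /L; lra.
have := @loop_integral_small (u n).1 ((u n).1 + r n * A) (u n).2 ((u n).2 + r n * C)
  x0 y0 p q s e (ltW e0) (x0P n) (y0P n) => /(_ _)/le_lt_trans; apply.
  move=> x y hx hy; apply: Ht.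
    have := x0P n; move: hx => /andP[? ?] /andP[? ?].
    by rewrite (le_lt_trans _ nt)// (le_trans _ rAL)// ler_norml; lra.
  have := y0P n; move: hy => /andP[? ?] /andP[? ?].
  by rewrite (le_lt_trans _ nt)// (le_trans _ rCL)// ler_norml; lra.
apply: (@le_lt_trans _ _ (2 * e * (r n * L) ^+ 2)).
  have e20 : 0 <= 2 * e by rewrite mulr_ge0// ltW.
  have E : ((u n).1 + r n * A - (u n).1) + ((u n).2 + r n * C - (u n).2) = r n * (A + C) by ring.
  rewrite (ler_wpM2l e20)// E lerXn2r// ?nnegrE; first by rewrite mulr_ge0 ?(ltW (r0 n))// addr_ge0.
    by rewrite mulr_ge0// ltW.
  by rewrite ler_wpM2l ?(ltW (r0 n))// /L; lra.
have -> : 2 * e * (r n * L) ^+ 2 = K * r n ^+ 2 / 2.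
  by rewrite /e; field; rewrite gt_eqF.
by rewrite ltr_pdivrMr// ltr_pMr ?mulr_gt0 ?exprn_gt0// ltr1n.
Qed.

End Goursat.

(** * Entire functions vanishing on the real line *)
Section identity_theorem.
Context {R : realType}.
Implicit Types (F : R[i] -> R[i]) (z w : R[i]).
Notation mu := (@lebesgue_measure R).
Import ComplexField.Normc.

(** Stated for an arbitrary isometric parametrization [p] and Lipschitz [phi],
    so as to cover horizontal and vertical lines, and real part, imaginary part
    and modulus, at once. *)
Lemma entire_line F (p : R -> R[i]) (phi : R[i] -> R) : entire F ->
  (forall s t, normc (p s - p t) = `|s - t|) ->
  (forall z w, `|phi z - phi w| <= normc (z - w)) ->
  continuous (fun t => phi (F (p t))).
Proof.
move=> eF pI phiL t; have [l /(_ 1 ltr01)[d d0 dF]] := (derivable_complexP _ _).1 (eF (p t)).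
have K0 : 0 < 1 + normc l by rewrite ltr_pwDl// normc_ge0.
apply/cvgrPdist_lt => e e0; have ee : 0 < e / (1 + normc l) by exact: divr_gt0.
near=> s.
have st : normc (p s - p t) < d by rewrite pI distrC; near: s; exact: cvgr_dist_lt.
rewrite distrC (le_lt_trans (phiL _ _))//.
have := dF _ st; rewrite mul1r (addrC (p t)) subrK => Fs.
rewrite -(subrK (l * (p s - p t)) (F (p s) - F (p t))).
rewrite (le_lt_trans (le_normcD _ _))// normcM.
apply: (@le_lt_trans _ _ ((1 + normc l) * `|s - t|)).
  by rewrite mulrDl mul1r -pI lerD2r.
rewrite mulrC -ltr_pdivlMr// distrC; near: s; exact: cvgr_dist_lt.
Unshelve. all: by end_near. Qed.

Lemma Re_lipschitz z w : `|complex.Re z - complex.Re w| <= normc (z - w).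
Proof. by rewrite -Re_opp -Re_add le_Re_normc. Qed.

Lemma Im_lipschitz z w : `|complex.Im z - complex.Im w| <= normc (z - w).
Proof. by rewrite -Im_opp -Im_add le_Im_normc. Qed.

Lemma normc_lipschitz z w : `|normc z - normc w| <= normc (z - w).
Proof.
have := le_normcD (z - w) w; have := le_normcD (w - z) z.
rewrite !subrK -(opprB z w) normcN ler_norml; lra.
Qed.

Lemma horizontal_isometry (y s t : R) : normc ((s +i* y) - (t +i* y)) = `|s - t|.
Proof. by rewrite /= subrr expr0n addr0 sqrtr_sqr. Qed.

Lemma vertical_isometry (x s t : R) : normc ((x +i* s) - (x +i* t)) = `|s - t|.
Proof. by rewrite /= subrr expr0n add0r sqrtr_sqr. Qed.

(** The form is Re (F dz); its closedness is one of the Cauchy-Riemann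
    equations.  Applied to c F for a constant c, it gives every real component of
    the circulation of F dz. *)
Lemma entire_loop_integral F (a b c d : R) : entire F -> a <= b -> c <= d ->
  loop_integral (fun x y => complex.Re (F (x +i* y)))
                (fun x y => - complex.Im (F (x +i* y))) a b c d = 0.
Proof.
move=> eF; apply: loop_integral_eq0.
- move=> y; apply: (entire_line (phi := @complex.Re R) (p := fun x => x +i* y)) => //.
    by move=> s t; exact: horizontal_isometry.
  exact: Re_lipschitz.
- move=> x y; apply: cvgN; move: y.
  apply: (entire_line (phi := @complex.Im R) (p := fun y => x +i* y)) => //.
    by move=> s t; exact: vertical_isometry.
  exact: Im_lipschitz.
move=> x0 y0; have [[p r] Hl] := (derivable_complexP _ _).1 (eF (x0 +i* y0)).
exists p, (- r), (- p) => e e0; have [d0 d00 Hd] := Hl _ e0.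
exists (d0 / 2); first exact: divr_gt0.
move=> x y hx hy; pose h := (x - x0) +i* (y - y0).
have hN : normc h <= `|x - x0| + `|y - y0| by exact: normc_le_ReIm.
have hd : normc h < d0.
  by rewrite (le_lt_trans hN)// [ltRHS]splitr ltrD.
have xyE : x +i* y = (x0 +i* y0) + h by rewrite /h; simpc; rewrite ![_ + (_ - _)]addrC !subrK.
have := Hd h hd; rewrite -xyE => Hh.
have {Hh}Hh : normc (F (x +i* y) - F (x0 +i* y0) - (p +i* r) * h) <= e * (`|x - x0| + `|y - y0|).
  by rewrite (le_trans Hh)// ler_wpM2l// ltW.
split; apply: le_trans Hh.
  apply: le_trans (le_Re_normc _).
  by rewrite !ReIm_add Re_mul/= mulNr.
apply: le_trans (le_Im_normc _).
rewrite !ReIm_add Im_mul/= -normrN le_eqVlt; apply/orP; left; apply/eqP; congr `|_|; ring.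
Qed.

(** As N grows, the Gaussian weight concentrates at x0, where g is positive.
    Within eta of x0 one has g >= g(x0)/2, so the integral over
    |x - x0| <= eta/2 is at least (g(x0)/2) eta exp(-N eta^2/4), whereas the
    negative part of the integral is O(exp(-N eta^2)).  If the whole integral is
    O(exp(-3 N b^2)), then B is O(exp(-N r)).  The constants B and r do not
    depend on N, which is what makes the estimate contradictory for large N. *)
Lemma gaussian_peak (g : R -> R) (x0 b : R) : 0 < b -> continuous g ->
  0 < g x0 -> exists B r : R, [/\ 0 < B, 0 < r & forall M C N : R, 0 <= M -> 0 <= N ->
  (forall x, x0 - 2 * b <= x <= x0 + 2 * b -> `|g x| <= M) ->
  \int[mu]_(x in `[x0 - 2 * b, x0 + 2 * b]) (g x * expR (- N * (x - x0) ^+ 2))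
    <= C * expR (- N * (3 * b ^+ 2)) -> 0 <= C ->
  B <= (C + 4 * b * M) * expR (- N * r)].
Proof.
move=> b0 cg g0.
have g20 : 0 < g x0 / 2 by rewrite divr_gt0.
have /cvgrPdist_lt/(_ _ g20)/nbhs_ballP[t /= t0 tg] := cg x0.
pose eta := Num.min (t / 2) b.
have eta0 : 0 < eta by rewrite lt_min b0 divr_gt0.
have etab : eta <= b by rewrite ge_min lexx orbT.
have etat : eta < t by rewrite gt_min ltr_pdivrMr// ltr_pMr// ltr1n.
have gpos x : `|x - x0| <= eta -> g x0 / 2 <= g x.
  move=> xe; have := tg x; rewrite /ball/= distrC => /(_ (le_lt_trans xe etat)).
  rewrite ltr_norml; lra.
clearbody eta; clear t t0 tg etat.
(* [r] is the gap eta^2 - (eta/2)^2 between the two exponents *)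
exists (eta * (g x0 / 2)), (3 / 4 * eta ^+ 2); split.
- exact: mulr_gt0.
- by rewrite mulr_gt0 ?exprn_gt0//; lra.
move=> M C N M0 N0 gM + C0; pose f x := g x * expR (- N * (x - x0) ^+ 2).
have cf : continuous f.
  move=> x; apply: cvgM; first exact: cg.
  apply: (@continuous_comp _ _ _ (fun x : R => - N * (x - x0) ^+ 2) expR);
    last exact: continuous_expR.
  apply: cvgM; first exact: cvg_cst.
  by apply: cvgM; apply: cvgB; [exact: cvg_id|exact: cvg_cst|exact: cvg_id|exact: cvg_cst].
rewrite -/f; set h := eta / 2.
have h0 : 0 < h by rewrite divr_gt0.
have heta : h <= eta by rewrite /h; lra.
rewrite (@Rintegral_segment_cat _ f _ _ (x0 - h))//; [|lra|lra].
rewrite (@Rintegral_segment_cat _ f (x0 - h) _ (x0 + h))//; [|lra|lra].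
pose E := expR (- N * eta ^+ 2).
have fge x : x0 - 2 * b <= x <= x0 + 2 * b -> - (M * E) <= f x.
  move=> xb; have [xe|xe] := leP `|x - x0| eta.
    apply: (@le_trans _ _ 0); first by rewrite oppr_le0 mulr_ge0// expR_ge0.
    by rewrite mulr_ge0 ?expR_ge0// (le_trans _ (gpos _ xe))// ltW.
  have : `|f x| <= M * E; last by rewrite ler_norml => /andP[].
  rewrite /f normrM (ger0_norm (expR_ge0 _)) ler_pM ?expR_ge0 ?gM//.
  rewrite ler_expR !mulNr lerN2 ler_wpM2l// -[leRHS]real_normK ?num_real//.
  by rewrite lerXn2r ?nnegrE ?normr_ge0// ltW.
have i1 : - (M * E) * ((x0 - h) - (x0 - 2 * b)) <= \int[mu]_(x in `[x0 - 2 * b, x0 - h]) f x.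
  apply: Rintegral_segment_ge => //; [lra|move=> x /andP[? ?]; apply: fge; lra].
have i3 : - (M * E) * ((x0 + 2 * b) - (x0 + h)) <= \int[mu]_(x in `[x0 + h, x0 + 2 * b]) f x.
  apply: Rintegral_segment_ge => //; [lra|move=> x /andP[? ?]; apply: fge; lra].
have i2 : (g x0 / 2 * expR (- N * h ^+ 2)) * ((x0 + h) - (x0 - h))
    <= \int[mu]_(x in `[x0 - h, x0 + h]) f x.
  apply: Rintegral_segment_ge => //; first lra.
  move=> x xh; have xx : `|x - x0| <= h by move: xh => /andP[? ?]; rewrite ler_norml; lra.
  rewrite /f ler_pM ?expR_ge0 ?(ltW g20)//; first by apply: gpos; exact: le_trans xx _.
  rewrite ler_expR !mulNr lerN2 ler_wpM2l// -[leLHS]real_normK ?num_real//.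
  by rewrite lerXn2r ?nnegrE ?normr_ge0// ltW.
have EC : C * expR (- N * (3 * b ^+ 2)) <= C * E.
  rewrite ler_wpM2l// ler_expR !mulNr lerN2 ler_wpM2l//.
  have : eta ^+ 2 <= b ^+ 2 by rewrite lerXn2r ?nnegrE ?(ltW b0)// ltW.
  have : 0 <= b ^+ 2 by exact: sqr_ge0.
  lra.
move=> iC.
have EE : E = expR (- N * (3 / 4 * eta ^+ 2)) * expR (- N * h ^+ 2).
  by rewrite -expRD; congr expR; rewrite /h; field.
rewrite -(ler_pM2r (expR_gt0 (- N * h ^+ 2))).
rewrite -(mulrA _ (expR (- N * (3 / 4 * eta ^+ 2)))) -EE.
have ME : 0 <= M * E * h by rewrite !mulr_ge0 ?expR_ge0// ltW.
have -> : eta = 2 * h by rewrite /h; field.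
lra.
Qed.


Lemma entire_bounded_segment F (p : R -> R[i]) (a b : R) : entire F ->
  (forall s t, normc (p s - p t) = `|s - t|) -> a <= b ->
  exists2 M : R, 0 <= M & forall t, a <= t <= b -> normc (F (p t)) <= M.
Proof.
move=> eF pI ab; have cF := entire_line eF pI normc_lipschitz.
have [|c _ cM] := @EVT_max R (fun t => normc (F (p t))) a b ab.
  exact: continuous_subspaceT.
exists (normc (F (p c))); first exact: normc_ge0.
by move=> t tab; apply: cM; rewrite in_itv.
Qed.

(** The rectangle is [x0 - 2b, x0 + 2b] x [0, b].  Its half-width 2b exceeds its
    height, so that Re (z - z0)^2 >= 3 b^2 on the vertical sides.  The factor
    conj (F z0) makes the integrand on the top side have positive real part at
    z0. *)
Lemma entire_eq0_upper F (x0 b : R) : entire F -> (forall u : R, F u%:C = 0) ->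
  0 < b -> F (x0 +i* b) = 0.
Proof.
move=> eF F0 b0; apply/eqP/negPn/negP => Fz0; pose z0 := x0 +i* b.
pose G z := (F z0)^* * F z.
have eG : entire G := entireM (@entire_cst R _) eF.
have x0b : x0 - 2 * b <= x0 + 2 * b by lra.
have hI y := @horizontal_isometry y.
have vI x := @vertical_isometry x.
have [M1 M10 HM1] := entire_bounded_segment eG (hI b) x0b.
have [M2 M20 HM2] := entire_bounded_segment eG (vI (x0 - 2 * b)) (ltW b0).
have [M3 M30 HM3] := entire_bounded_segment eG (vI (x0 + 2 * b)) (ltW b0).
pose M := M1 + M2 + M3; have M0 : 0 <= M by rewrite /M; lra.
pose g x := complex.Re (G (x +i* b)).
have cg : continuous g.
  exact: (entire_line eG (hI b) Re_lipschitz).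
have g0 : 0 < g x0.
  rewrite /g /G -/z0; move: Fz0; rewrite -/z0; case: (F z0) => u v; rewrite eq_complex/=.
  rewrite negb_and mulNr opprK -!expr2 => /orP[u0|v0].
    by rewrite ltr_pwDl ?sqr_ge0// exprn_even_gt0.
  by rewrite ltr_wpDl ?sqr_ge0// exprn_even_gt0.
have [B [r [B0 r0 Br]]] := gaussian_peak b0 cg g0.
pose C := 2 * M * b; have C0 : 0 <= C by rewrite !mulr_ge0// ltW.
have key (N : R) : 0 <= N -> B <= (C + 4 * b * M) * expR (- N * r).
  move=> N0; apply: Br => // [x hx|].
    by rewrite (le_trans (le_Re_normc _))// (le_trans (HM1 x hx))// /M; lra.
  pose Phi z := G z * cexp ((- N)%:C * (z - z0) ^+ 2).
  have ePhi : entire Phi.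
    apply: (entireM eG); apply: (entire_comp (@entire_cexp R)).
    apply: (entireM (@entire_cst R _)); apply: entireX.
    exact: entireB (@entire_id R) (@entire_cst R _).
  have PhiN x y m : normc (G (x +i* y)) <= m ->
      (x - x0) ^+ 2 = 4 * b ^+ 2 -> 0 <= y <= b ->
      normc (Phi (x +i* y)) <= m * expR (- N * (3 * b ^+ 2)).
    move=> Gm xx /andP[y0 yb]; rewrite /Phi normcM ler_pM ?normc_ge0//.
    rewrite normc_cexp ler_expR /z0 expr2 Re_mul/= -!expr2 mul0r subr0 xx.
    rewrite !mulNr lerN2 ler_wpM2l//.
    have : (y - b) ^+ 2 <= b ^+ 2.
      by rewrite -sqrrN opprB lerXn2r ?nnegrE ?subr_ge0 ?(ltW b0)// lerBlDr lerDl.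
    lra.
  have := entire_loop_integral ePhi x0b (ltW b0).
  rewrite /loop_integral.
  under eq_Rintegral => x _ do rewrite {1}/Phi {1}/G complexr0 F0 mulr0 mul0r sub0r -mulN1r.
  rewrite RintegralZl//; last first.
    exact/integrable_continuous_segment/(entire_line ePhi (hI b) Re_lipschitz).
  under eq_Rintegral => x _.
    have -> : complex.Re (Phi (x +i* b)) = g x * expR (- N * (x - x0) ^+ 2).
      have E : (x +i* b) - z0 = (x - x0)%:C by rewrite -[LHS]/((x - x0) +i* (b - b)) subrr.
      by rewrite /Phi E -rmorphXn -rmorphM cexp_real Re_mul/= mulr0 subr0.
    over.
  rewrite mulN1r addrC => /subr0_eq <-.
  pose f y := - complex.Im (Phi ((x0 + 2 * b) +i* y)) - - complex.Im (Phi ((x0 - 2 * b) +i* y)).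
  rewrite -/f; pose E := expR (- N * (3 * b ^+ 2)).
  have cf : continuous f.
    by move=> y; rewrite /f; apply: cvgB; apply: cvgN;
      apply: (entire_line ePhi (vI _) Im_lipschitz).
  have := @Rintegral_segment_near R f 0 b 0 (2 * (M * E)) cf (ltW b0).
  rewrite mul0r !subr0 => /(_ _)/(le_trans (ler_norm _)).
  have -> : 2 * (M * E) * b = C * E by rewrite /C; ring.
  apply => y yb; rewrite subr0 /f.
  rewrite (le_trans (ler_normB _ _))// !normrN [leRHS]mulr_natl mulr2n lerD//.
    rewrite (le_trans (le_Im_normc _))//; apply: PhiN => //; last ring.
    by rewrite (le_trans (HM3 y yb))// /M; lra.
  rewrite (le_trans (le_Im_normc _))//; apply: PhiN => //; last ring.
  by rewrite (le_trans (HM2 y yb))// /M; lra.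
(* for this N, exp(N r) >= 1 + N r already exceeds the allowed ratio *)
have := key ((C + 4 * b * M) / (B * r)) _.
set D := C + 4 * b * M.
have D0 : 0 <= D by rewrite /D !addr_ge0// !mulr_ge0// ltW.
move=> /(_ (divr_ge0 D0 (ltW (mulr_gt0 B0 r0)))).
rewrite mulNr expRN ler_pdivlMr ?expR_gt0//.
have -> : D / (B * r) * r = D / B by field; rewrite ?gt_eqF.
have := expR_ge1Dx (D / B) => /(ler_wpM2l (ltW B0)) BD /(le_trans BD).
by rewrite mulrDr mulr1 mulrCA divff ?gt_eqF// mulr1 gerDr leNgt B0.
Qed.

(** The lower half-plane is reached by applying the upper one to F(-z). *)
Theorem entire_eq0_real F : entire F -> (forall u : R, F u%:C = 0) -> forall z, F z = 0.
Proof.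
move=> eF F0 [x y]; have [y0|y0|->] := ltrgt0P y.
- exact: entire_eq0_upper.
- have eFN : entire (F \o -%R).
    apply: (entire_comp eF) => z; apply: derivableN; exact: derivable_id.
  have := @entire_eq0_upper (F \o -%R) (- x) (- y) eFN.
  rewrite -[(- x) +i* (- y)]/(- (x +i* y)) /= opprK; apply; last by rewrite oppr_gt0.
  by move=> u; rewrite /= -rmorphN F0.
- exact: F0.
Qed.

End identity_theorem.

(** * Integrating polynomials against a Gaussian *)
Section gaussian_functional.
Context {R : realType}.
Notation mu := (@lebesgue_measure R).
Implicit Types (p q : {poly R}) (m x : R).

Definition bell m x : R := expR (- (x - m) ^+ 2).

Lemma bell_ge0 m x : 0 <= bell m x. Proof. exact: expR_ge0. Qed.

Lemma normal_pdf_bell m x :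
  normal_pdf m (Num.sqrt 2)^-1 x = (Num.sqrt pi)^-1 * bell m x.
Proof.
have s0 : (Num.sqrt 2 : R)^-1 != 0 by rewrite invr_eq0 sqrtr_eq0 -ltNge.
have s2 : ((Num.sqrt 2 : R)^-1) ^+ 2 *+ 2 = 1.
  by rewrite exprVn sqr_sqrtr// -mulr_natr mulVf.
rewrite normal_pdfE// /normal_peak /normal_fun /bell.
by rewrite -mulrnAl s2 mul1r divr1.
Qed.

Lemma sqrt_pi_neq0 : Num.sqrt pi != 0 :> R.
Proof. by rewrite sqrtr_eq0 -ltNge pi_gt0. Qed.

Lemma bell_normal_pdf m x :
  bell m x = Num.sqrt pi * normal_pdf m (Num.sqrt 2)^-1 x.
Proof. by rewrite normal_pdf_bell mulVKf// sqrt_pi_neq0. Qed.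

Lemma integrable_bell m : mu.-integrable setT (EFin \o bell m).
Proof.
have := integrableZl measurableT (Num.sqrt pi)
  (integrable_normal_pdf m (Num.sqrt 2)^-1).
by apply: eq_integrable => // x _ /=; rewrite bell_normal_pdf EFinM.
Qed.

Lemma Rintegral_bell m : \int[mu]_x bell m x = Num.sqrt pi.
Proof.
under eq_Rintegral do rewrite bell_normal_pdf.
rewrite RintegralZl//; last exact: integrable_normal_pdf.
by rewrite /Rintegral integral_normal_pdf mulr1.
Qed.

Lemma is_derive_bell m x : is_derive x 1 (bell m) (- 2 * (x - m) * bell m x).
Proof.
by apply: is_derive_eq; rewrite /bell/GRing.scale/=; ring.
Qed.

Lemma continuous_bell m : continuous (bell m).
Proof.
move=> x; apply/differentiable_continuous/derivable1_diffP.
by have [] := is_derive_bell m x.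
Qed.

(** Completing the square: an exponential factor only shifts the Gaussian. *)
Lemma expRM_bell m a x :
  expR (2 * a * x) * bell m x = expR (2 * a * m + a ^+ 2) * bell (m + a) x.
Proof. by rewrite /bell -!expRD; congr expR; ring. Qed.

Lemma poly_le_expR p : exists2 K : R, 0 <= K &
  forall x, `|p.[x]| <= K * (expR x + expR (- x)).
Proof.
exists (\sum_(i < size p) `|p`_i| * i`!%:R).
  by apply: sumr_ge0 => i _; rewrite mulr_ge0.
move=> x; rewrite horner_coef (le_trans (ler_norm_sum _ _ _))// mulr_suml.
apply: ler_sum => i _; rewrite normrM -mulrA ler_wpM2l// normrX.
have i0 : 0 < (i`!%:R : R) by rewrite ltr0n fact_gt0.
have : `|x| ^+ i / i`!%:R <= expR `|x|.
  case: (nat_of_ord i) => [|n].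
    by rewrite expr0 fact0 divr1 -expR0 ler_expR.
  by apply: le_trans (expR_ge1Dxn n (normr_ge0 x)); rewrite lerDr.
rewrite ler_pdivrMr// mulrC => /le_trans; apply; rewrite (ler_wpM2l (ltW i0))//.
by case: (ger0P x) => _; [rewrite lerDl|rewrite lerDr]; exact: expR_ge0.
Qed.

(** Since |p(x)| is O(e^x + e^-x), a polynomial times a Gaussian is dominated
    by two shifted Gaussians, which are integrable. *)
Lemma poly_bell_le p m : exists2 K : R, 0 <= K &
  forall x, `|p.[x] * bell m x| <= K * (bell (m + 2^-1) x + bell (m - 2^-1) x).
Proof.
have [K K0 pK] := poly_le_expR p.
pose c1 := expR (m + 4^-1); pose c2 := expR (- m + 4^-1).
exists (K * (c1 + c2)); first by rewrite mulr_ge0// addr_ge0 ?expR_ge0.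
move=> x; rewrite normrM (ger0_norm (bell_ge0 _ _)).
apply: (le_trans (ler_wpM2r (bell_ge0 m x) (pK x))).
rewrite -!mulrA ler_wpM2l//.
have e1 : expR x * bell m x = c1 * bell (m + 2^-1) x.
  have := expRM_bell m 2^-1 x; rewrite /c1.
  by rewrite divff// !mul1r => ->; congr (expR _ * _); field.
have e2 : expR (- x) * bell m x = c2 * bell (m - 2^-1) x.
  have := expRM_bell m (- 2^-1) x; rewrite /c2.
  by rewrite mulrN divff// !mulN1r => ->; congr (expR _ * _); field.
rewrite mulrDl e1 e2 mulrDr !mulrDl.
have := bell_ge0 (m + 2^-1) x; have := bell_ge0 (m - 2^-1) x.
move=> b1 b2; have c10 : 0 <= c1 by exact: expR_ge0.
have c20 : 0 <= c2 by exact: expR_ge0.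
by rewrite lerD// ?lerDl ?lerDr mulr_ge0.
Qed.

Lemma measurable_poly_bell p m : measurable_fun setT (fun x => p.[x] * bell m x).
Proof.
apply: continuous_measurable_fun => x; apply: cvgM; first exact: continuous_horner.
exact: continuous_bell.
Qed.

Lemma integrable_poly_bell p m :
  mu.-integrable setT (EFin \o (fun x => p.[x] * bell m x)).
Proof.
have [K K0 pK] := poly_bell_le p m.
apply: (@le_integrable _ _ _ mu setT measurableT _
  (EFin \o (fun x => K * (bell (m + 2^-1) x + bell (m - 2^-1) x)))).
- by apply/measurable_EFinP; exact: measurable_poly_bell.
- move=> x _ /=; rewrite lee_fin (le_trans (pK x))//; exact: ler_norm.
- have := integrableZl measurableT K (integrableD measurableT
    (integrable_bell (m + 2^-1)) (integrable_bell (m - 2^-1))).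
  by apply: eq_integrable => // x _ /=; rewrite EFinM EFinD.
Qed.

(** From t^2 >= t - 1/4 with t = |x - m| >= |x| - |m|. *)
Lemma bell_le m x : bell m x <= expR (`|m| + 4^-1) * expR (- `|x|).
Proof.
rewrite -expRD ler_expR.
have := sqr_ge0 (`|x - m| - 2^-1); rewrite sqrrB.
rewrite -[`|x - m| ^+ 2]normrX ger0_norm ?sqr_ge0// -mulr_natr.
have : `|x| <= `|x - m| + `|m| by rewrite -{1}(subrK m x) ler_normD.
have -> : (2^-1 : R) ^+ 2 = 4^-1 by field.
have -> : `|x - m| / 2 * 2 = `|x - m| by field.
lra.
Qed.

Lemma poly_bell_decay p m (s : R ^nat) : (forall n, `|s n| = n%:R) ->
  (fun n => p.[s n] * bell m (s n)) @ \oo --> 0.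
Proof.
move=> sn; have [K K0 pK] := poly_bell_le p m.
pose D := K * (expR (`|m + 2^-1| + 4^-1) + expR (`|m - 2^-1| + 4^-1)).
apply: norm_cvg0; apply: (@squeeze_cvgr _ _ _ _ (fun=> 0) (fun n : nat => D * expR (- n%:R))).
- apply: nearW => n; rewrite normr_ge0/= (le_trans (pK _))// -mulrA ler_wpM2l//.
  by rewrite mulrDl; apply: lerD; rewrite -(sn n); exact: bell_le.
- exact: cvg_cst.
- rewrite -[X in _ --> X](mulr0 D); apply: cvgM; first exact: cvg_cst.
  exact: cvgn_expR.
Qed.

(** The integral over [-n, n] is a difference of boundary values, which decay;
    dominated convergence passes to the whole line. *)
Lemma Rintegral_derive_poly_bell p q m :
  (forall x, is_derive x 1 (fun x => p.[x] * bell m x) (q.[x] * bell m x)) ->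
  \int[mu]_x (q.[x] * bell m x) = 0.
Proof.
move=> dF; pose F x := p.[x] * bell m x; pose f x := q.[x] * bell m x.
(* indices start at 1 so that the segments are non-degenerate *)
pose f_ (n : nat) := (EFin \o f) \_ `[- n.+1%:R, n.+1%:R].
have cf : continuous f.
  by move=> x; apply: cvgM; [exact: continuous_horner|exact: continuous_bell].
have cF : continuous F.
  by move=> x; apply: cvgM; [exact: continuous_horner|exact: continuous_bell].
have f_E n : (\int[mu]_x f_ n x = (F n.+1%:R - F (- n.+1%:R))%:E)%E.
  rewrite /f_ -integral_mkcond.
  rewrite EFinB; apply: continuous_FTC2.
  - by rewrite -subr_gt0 opprK addr_gt0.
  - exact: continuous_subspaceT.
  - split.
    + by move=> x _; have [] := dF x.
    + exact/cvg_at_right_filter/cF.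
    + exact/cvg_at_left_filter/cF.
  - by move=> x _; rewrite derive1E; have [_ ->] := dF x.
have mf : measurable_fun setT (EFin \o f).
  by apply/measurable_EFinP; exact: measurable_poly_bell.
have mf_ n : measurable_fun setT (f_ n).
  apply/(measurable_restrictT _ _).1 => //; exact: measurable_funTS.
have f_f : {ae mu, forall x, setT x -> f_ ^~ x @ \oo --> (EFin \o f) x}.
  apply: aeW => x _; apply: cvg_near_cst; near=> n.
  rewrite /f_ patchE mem_set//= in_itv/= -ler_norml.
  rewrite (@le_trans _ _ n%:R) ?ler_nat//.
  by near: n; exact: nbhs_infty_ger.
have ig : mu.-integrable setT (fun x => `|f x|%:E).
  by have := integrable_norm (integrable_poly_bell q m).
have f_g : {ae mu, forall x n, setT x -> (`|f_ n x| <= `|f x|%:E)%E}.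
  apply: aeW => x n _; rewrite /f_ patchE; case: ifPn => _ //=.
  by rewrite lee_fin normr0.
have [_ _] := @dominated_convergence _ _ R mu setT measurableT f_ (EFin \o f)
  (fun x => `|f x|%:E) mf_ mf f_f ig f_g.
under eq_fun do rewrite f_E.
move=> lim1.
have lim0 : (fun n => (F n.+1%:R - F (- n.+1%:R))%:E) @ \oo --> 0%E.
  apply/fine_cvgP; split; first exact: nearW.
  have c1 := @poly_bell_decay p m (fun n => n%:R) (fun n => normr_nat _ n).
  have c2 := @poly_bell_decay p m (fun n => - n%:R) (fun n => etrans (normrN _) (normr_nat _ n)).
  have := cvgB c1 c2; rewrite subrr; rewrite -cvg_shiftS; exact.
rewrite /Rintegral. have -> : (\int[mu]_x (q.[x] * bell m x)%:E)%E = 0%E; last by [].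
exact: (cvg_unique _ lim1 lim0).
Unshelve. all: by end_near. Qed.

(** Integration by parts: the difference of the two integrands is minus the
    derivative of p exp(-(x - m)^2). *)
Lemma Rintegral_bell_recurrence p m :
  \int[mu]_x ((2 *: 'X * p - p^`()).[x] * bell m x) =
  2 * m * \int[mu]_x (p.[x] * bell m x).
Proof.
pose q := p^`() - 2 *: ('X - m%:P) * p.
have dF x : is_derive x 1 (fun x => p.[x] * bell m x) (q.[x] * bell m x).
  have := is_derive_bell m x => ?; apply: is_derive_eq.
  by rewrite /q /GRing.scale/= !(hornerD, hornerN, hornerM, hornerZ, hornerX, hornerC); ring.
have E x : (2 *: 'X * p - p^`()).[x] * bell m x = 2 * m * (p.[x] * bell m x)
   - q.[x] * bell m x.
  by rewrite /q !(hornerD, hornerN, hornerM, hornerZ, hornerX, hornerC); ring.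
under eq_Rintegral do rewrite E.
have iq := integrable_poly_bell q m.
rewrite RintegralB//; last first.
  have := integrableZl measurableT (2 * m) (integrable_poly_bell p m).
  by apply: eq_integrable => // x _ /=; rewrite EFinM.
rewrite RintegralZl//; last exact: integrable_poly_bell.
by rewrite (Rintegral_derive_poly_bell dF) subr0.
Qed.

End gaussian_functional.

(** * The convolution of Hermite functions with the Gaussian *)
Section hermite_convolution.
Context {R : realType}.
Notation mu := (@lebesgue_measure R).
Implicit Types (H : nat -> {poly R}).

(** This is - exp(x^2) (exp(-x^2) p)', the step of Rodrigues' formula. *)
Definition hermite_step (p : {poly R}) : {poly R} := 2 *: 'X * p - p^`().

(** The commutation of d/dx with p -> 2X p - p' adds 2p at each step. *)
Lemma deriv_hermite_step n :
  (iter n.+1 hermite_step 1)^`() = (2 * n.+1%:R) *: iter n hermite_step 1.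
Proof.
elim: n => [|n ih].
  rewrite /= /hermite_step -(polyC1) derivC subr0 polyC1 mulr1 derivZ derivX.
  by rewrite mulr1.
rewrite [iter n.+2 _ _]iterS {1}/hermite_step derivB derivM ih !derivZ derivX.
rewrite alg_polyC (_ : 2%:P = 2%:R%:P)//.
have -> : iter n.+1 hermite_step 1 =
  2 *: 'X * iter n hermite_step 1 - (iter n hermite_step 1)^`() by rewrite iterS.
set g := iter n hermite_step 1.
rewrite -!mul_polyC !polyCM; rewrite -natr1 polyCD.
have -> : (n.+2%:R)%:P = n.+1%:R%:P + 1 :> {poly R} by rewrite -natr1 polyCD.
ring.
Qed.

Lemma hermite_polynomials_iter H n x : hermite_polynomials H ->
  (H n).[x] = (iter n hermite_step 1).[x].
Proof.
move=> HH; have [H0 HS] := hermite_rec x HH.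
suff : (H n).[x] = (iter n hermite_step 1).[x] /\
       (H n.+1).[x] = (iter n.+1 hermite_step 1).[x] by case.
elim: n => [|n [ih1 ih2]].
  split; first by rewrite H0 hornerC.
  rewrite HS H0 /= /hermite_step -polyC1 derivC subr0 hornerM hornerZ hornerX hornerC.
  by ring.
split=> //; rewrite HS [n.+1.-1]/= ih1 ih2.
have -> : iter n.+2 hermite_step 1 =
  2 *: 'X * iter n.+1 hermite_step 1 - (iter n.+1 hermite_step 1)^`() by [].
rewrite deriv_hermite_step; move: (iter n.+1 _ _) (iter n _ _) => g1 g0.
by rewrite hornerD hornerN hornerM !hornerZ hornerX; ring.
Qed.

Lemma Rintegral_hermite_bell H n m : hermite_polynomials H ->
  \int[mu]_x ((H n).[x] * bell m x) = (2 * m) ^+ n * Num.sqrt pi.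
Proof.
move=> HH; under eq_Rintegral do rewrite hermite_polynomials_iter//.
elim: n => [|n ih].
  under eq_Rintegral do rewrite hornerC mul1r.
  by rewrite expr0 mul1r Rintegral_bell.
by rewrite iterS Rintegral_bell_recurrence ih exprS mulrA.
Qed.

(** The exponents combine by
    (u - x)^2/2 + x^2/2 = u^2/4 + (x - u/2)^2, so the integral is a Gaussian
    moment of H_n centred at u/2, namely u^n sqrt(pi). *)
Lemma convolution_psi0_hermite H n u : hermite_polynomials H ->
  convolution_psi0 H (hermite_function H n) u =
  expR (- (u ^+ 2 / 4)) * u ^+ n / Num.sqrt (n`!%:R * 2 ^+ n).
Proof.
move=> HH; rewrite /convolution_psi0 /convolution.
have H0 x : (H 0%N).[x] = 1 by have [] := hermite_rec x HH.
(* both normalizing constants contain the fourth root of pi *)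
set s := Num.sqrt (Num.sqrt (pi : R)).
have s0 : s != 0 by rewrite sqrtr_eq0 -ltNge sqrtr_gt0 pi_gt0.
have ss : s ^+ 2 = Num.sqrt pi by rewrite sqr_sqrtr// sqrtr_ge0.
pose c : R := Num.sqrt (n`!%:R * 2 ^+ n).
have c0 : c != 0.
  by rewrite sqrtr_eq0 -ltNge mulr_gt0 ?exprn_gt0// ltr0n fact_gt0.
pose k := expR (- (u ^+ 2 / 4)) / (s * (c * s)).
have E x : hermite_function H 0 (u - x) * hermite_function H n x =
    k * ((H n).[x] * bell (u / 2) x).
  rewrite /hermite_function H0 fact0 expr0 !mul1r -/s sqrtrM; last first.
    by rewrite mulr_ge0// exprn_ge0.
  rewrite -/s -/c /k.
  have : expR (- ((u - x) ^+ 2 / 2)) * expR (- (x ^+ 2 / 2)) =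
         expR (- (u ^+ 2 / 4)) * bell (u / 2) x.
    by rewrite /bell -!expRD; congr expR; field.
  set e1 := expR _; set e2 := expR _; set e3 := expR _ => e123.
  transitivity ((e1 * e2) * (H n).[x] / (s * (c * s))); first by field; rewrite s0 c0.
  by rewrite e123; ring.
under eq_Rintegral do rewrite E.
have iH : mu.-integrable setT (EFin \o (fun x => (H n).[x] * bell (u / 2) x)).
  exact: integrable_poly_bell.
rewrite RintegralZl// Rintegral_hermite_bell// -ss /k -/c.
have -> : 2 * (u / 2) = u by field.
by field; rewrite s0 c0.
Qed.

End hermite_convolution.

(** * The reproducing kernel *)
Section reproducing_kernel.
Context {R : realType}.

Definition Tpsi_entire n (z : R[i]) : R[i] :=
  cexp (- (z ^+ 2 / 4)) * z ^+ n * ((Num.sqrt (n`!%:R * 2 ^+ n : R))^-1)%:C.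

Lemma entire_Tpsi n : entire (Tpsi_entire n).
Proof.
apply: entireM; last exact: entire_cst.
apply: entireM; last by apply: entireX; exact: entire_id.
apply: (entire_comp (@entire_cexp R)).
rewrite [X in entire X](_ : _ = fun z : R[i] => - 4^-1 * z ^+ 2).
  by apply: (entireM (@entire_cst R _)); apply: entireX; exact: entire_id.
by apply/funext => z; rewrite mulNr mulrC.
Qed.

Lemma Tpsi_entire_extension (H : nat -> {poly R}) n : hermite_polynomials H ->
  entire_extension (convolution_psi0 H (hermite_function H n)) (Tpsi_entire n).
Proof.
move=> HH; split; first exact: entire_Tpsi.
move=> u; rewrite convolution_psi0_hermite// /Tpsi_entire !rmorphM rmorphXn.
congr (_ * _ * _); rewrite -[RHS]cexp_real; congr cexp.
by rewrite rmorphN rmorphM rmorphXn fmorphV rmorph_nat.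
Qed.

(** The difference of two extensions is entire and vanishes on the real line. *)
Lemma entire_extension_unique (f : R -> R) (F G : R[i] -> R[i]) :
  entire_extension f F -> entire_extension f G -> F = G.
Proof.
move=> [eF Ff] [eG Gf]; apply/funext => z; apply/subr0_eq.
by apply: (entire_eq0_real (entireB eF eG)) => u; rewrite Ff Gf subrr.
Qed.

Lemma conj_Tpsi_entire n (w : R[i]) :
  conjc (Tpsi_entire n w) = Tpsi_entire n (conjc w).
Proof.
have conjM (x y : R[i]) : conjc (x * y) = conjc x * conjc y by exact: rmorphM.
have conjX (x : R[i]) k : conjc (x ^+ k) = conjc x ^+ k by exact: rmorphXn.
have conjN (x : R[i]) : conjc (- x) = - conjc x by exact: rmorphN.
rewrite /Tpsi_entire 2!conjM conj_cexp conjX conjc_real conjN conjM conjX.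
by rewrite conjc_inv conjc_nat.
Qed.

Lemma Tpsi_entireM n (z w : R[i]) :
  Tpsi_entire n z * Tpsi_entire n w =
  cexp (- (z ^+ 2 / 4)) * cexp (- (w ^+ 2 / 4)) * ((z * w / 2) ^+ n / n`!%:R).
Proof.
rewrite /Tpsi_entire.
have : ((Num.sqrt (n`!%:R * 2 ^+ n : R))^-1)%:C ^+ 2 = (n`!%:R * 2 ^+ n)^-1 :> R[i].
  rewrite -rmorphXn exprVn sqr_sqrtr; last by rewrite mulr_ge0// exprn_ge0.
  by rewrite fmorphV rmorphM rmorphXn !rmorph_nat.
set c := _%:C => c2.
transitivity (cexp (- (z ^+ 2 / 4)) * cexp (- (w ^+ 2 / 4)) * ((z * w) ^+ n * c ^+ 2)).
  by rewrite exprMn; ring.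
rewrite c2 expr_div_n invfM; ring.
Qed.

End reproducing_kernel.

Unset Implicit Arguments.

Theorem proposition3p6 (R : realType) (H : nat -> {poly R})
    (H_hermite : hermite_polynomials H) :
  (forall n : nat, exists F : R[i] -> R[i],
     entire_extension (convolution_psi0 H (hermite_function H n)) F)
  /\
  (forall Tpsi : nat -> R[i] -> R[i],
     (forall n : nat,
        entire_extension (convolution_psi0 H (hermite_function H n))
          (Tpsi n)) ->
     forall z w : R[i],
       series (fun n : nat => Tpsi n z * (Tpsi n w)^*) @ \oo
         --> (K_RBF z w : R[i]^o)).
Proof.
split=> [n|Tpsi TpsiE z w].
  by exists (Tpsi_entire n); exact: Tpsi_entire_extension.
have TE n : Tpsi n = Tpsi_entire n.
  exact: entire_extension_unique (TpsiE n) (Tpsi_entire_extension n H_hermite).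
(* (z - w^* )^2 / 4 = z^2/4 + (w^* )^2/4 - z w^* / 2 *)
pose A := cexp (- (z ^+ 2 / 4)) * cexp (- ((conjc w) ^+ 2 / 4)).
have KE : K_RBF z w = A * cexp (z * conjc w / 2).
  by rewrite /A -!cexpD /K_RBF; congr cexp; field.
rewrite KE.
have E : series (fun n => Tpsi n z * (Tpsi n w)^*) =1
    (fun n => A * series (fun n => (z * conjc w / 2) ^+ n / n`!%:R) n).
  move=> n; rewrite /series/= mulr_sumr; apply: eq_bigr => i _.
  by rewrite TE -[Num.conj _]/(conjc (Tpsi_entire i w)) conj_Tpsi_entire Tpsi_entireM.
rewrite (eq_cvg _ _ E).
apply: (@cvgM _ _ _ _ (fun=> A) _ A); [exact: cvg_cst|exact: cvg_cexp].
Qed.
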